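(* Let $H\in(0,1)$, $K\in(0,1]$, $\alpha>0$, let $B_{H,K}$ be a bi-fractional Brownian motion with parameters $H,K$, and let $B_{H,K}^{\mathrm{LT}}(t)=e^{-\alpha HK t}B_{H,K}(e^{\alpha t})$ for $t\in\mathbb{R}$. Let $R_{B,\alpha}(t):=\mathbb{E}[B_{H,K}^{\mathrm{LT}}(t)B_{H,K}^{\mathrm{LT}}(0)]$. Then for every $t\in\mathbb{R}$, $$R_{B,\alpha}(t)=e^{-\alpha HK t}\,\mathbb{E}\bigl[B_{H,K}(e^{\alpha t})B_{H,K}(1)\bigr],$$ and explicitly $$R_{B,\alpha}(t)=2^{-K}e^{-\alpha HK t}\Bigl((e^{2\alpha H t}+1)^{K}-|e^{\alpha t}-1|^{2HK}\Bigr),\qquad t\in\mathbb{R}.$$ In particular, $R_{B,\alpha}(0)=1$ and $R_{B,\alpha}$ is an even function.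
   Context: A bi-fractional Brownian motion $B_{H,K}=\{B_{H,K}(t)\}_{t\ge0}$ with $H\in(0,1)$, $K\in(0,1]$ is a centred Gaussian process with covariance $$\mathbb{E}[B_{H,K}(t)B_{H,K}(s)]=2^{-K}\Bigl((t^{2H}+s^{2H})^{K}-|t-s|^{2HK}\Bigr),\qquad s,t\ge0.$$ *)

(* Defs.v *)
From mathcomp Require Import all_boot all_order all_algebra.
From mathcomp Require Import all_classical all_reals all_analysis.

Set Implicit Arguments.
Unset Strict Implicit.
Unset Printing Implicit Defensive.

Import Order.TTheory GRing.Theory Num.Theory.
Import numFieldNormedType.Exports.

Local Open Scope classical_set_scope.
Local Open Scope ring_scope.

(* A point mass counts as Gaussian, and is singled out here because the
   library's [normal_prob m 0] is the uniform law on [0, 1], not the point mass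
   at [m]. The second parameter of [normal_prob] is the standard deviation. *)
Definition gaussian_law (R : realType) (mu : set R -> \bar R) : Prop :=
  (exists m : R, forall A, measurable A -> mu A = \d_m A) \/
  (exists m s : R, 0 < s /\ forall A, measurable A -> mu A = normal_prob m s A).

Definition gaussian_process d (T : measurableType d) (R : realType)
    (P : probability T R) (I : Type) (X : I -> {RV P >-> R}) : Prop :=
  forall (n : nat) (t : 'I_n -> I) (a : 'I_n -> R),
    gaussian_law (pushforward P (fun w => \sum_(i < n) a i * X (t i) w)).

Definition centred_process d (T : measurableType d) (R : realType)
    (P : probability T R) (I : Type) (X : I -> {RV P >-> R}) : Prop :=
  forall t, ('E_P[X t] = 0)%E.

Definition bifractional_brownian_motion d (T : measurableType d)
    (R : realType) (P : probability T R) (H K : R)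
    (B : {nonneg R} -> {RV P >-> R}) : Prop :=
  [/\ gaussian_process B,
      centred_process B &
      forall t s : {nonneg R},
        'E_P[B t \* B s]%E =
        (2 `^ (- K) *
          ((t%:num `^ (2 * H) + s%:num `^ (2 * H)) `^ K
           - `|t%:num - s%:num| `^ (2 * H * K)))%:E ].

(* Lamperti transform of a process indexed by the half-line; its scaling
   exponent is H K for bi-fractional Brownian motion. *)
Definition lamperti d (T : measurableType d) (R : realType)
    (P : probability T R) (H K alpha : R) (B : {nonneg R} -> {RV P >-> R})
    (t : R) : T -> R :=
  fun w => expR (- (alpha * H * K * t)) * B (expR (alpha * t))%:nng w.

Definition R_B d (T : measurableType d) (R : realType)
    (P : probability T R) (H K alpha : R) (B : {nonneg R} -> {RV P >-> R})
    (t : R) : \bar R :=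
  ('E_P[lamperti H K alpha B t \* lamperti H K alpha B 0])%E.

(* Main.v *)
(* Pulling the deterministic
   Lamperti factor out of the expectation gives the explicit formula, and
   distributing e^(-alpha H K t) over its two terms turns it into
   2^-K ((e^(alpha H t) + e^(-alpha H t))^K
         - |e^(alpha t / 2) - e^(-alpha t / 2)|^(2 H K)),
   which is visibly invariant under t -> -t. *)

Require Import Defs.
From mathcomp Require Import all_boot all_order all_algebra.
From mathcomp Require Import ring.
From mathcomp Require Import all_classical all_reals all_analysis.
From mathcomp Require Import measurable_realfun.

Import Order.TTheory GRing.Theory Num.Theory.
Import numFieldNormedType.Exports.

Local Open Scope classical_set_scope.
Local Open Scope ring_scope.

(* Since -oo is absorbing in the sum +oo - oo, a finite integral forces both the
   positive and the negative part to have finite integral. *)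
Lemma fin_num_integral_integrable d (T : measurableType d) (R : realType)
    (mu : {measure set T -> \bar R}) (D : set T) (f : T -> \bar R) :
  measurable D -> measurable_fun D f ->
  (\int[mu]_(x in D) f x)%E \is a fin_num -> mu.-integrable D f.
Proof.
move=> mD mf; rewrite integralE fin_numB => /andP[fp fn].
apply/integrableP; split=> //.
rewrite -[fun x => _]/(abse \o f) fune_abse ge0_integralD//.
- by rewrite lte_add_pinfty// ltey_eq ?fp ?fn.
- exact: measurable_funepos.
- exact: measurable_funeneg.
Qed.

(** Assuming a finite expectation rather than integrability suits the covariance formula, whose
    right-hand side is visibly a real number. *)
Lemma fin_num_expectationZl d (T : measurableType d) (R : realType)
    (P : probability T R) (X : T -> R) (c : R) :
  measurable_fun setT X -> 'E_P[X]%E \is a fin_num ->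
  'E_P[(fun w => c * X w)%R]%E = (c%:E * 'E_P[X])%E.
Proof.
move=> mX; rewrite unlock => EX.
have iX : P.-integrable setT (EFin \o X).
  by apply: fin_num_integral_integrable => //; exact/measurable_EFinP.
by rewrite -integralZl.
Qed.

(** The prefactor is both the [K]-th power of [expR (- (a * H * t))] and the [2 * H * K]-th power of
    [expR (- (a * t / 2))], so it can be absorbed into either base. *)
Lemma lamperti_covariance_symmetric (R : realType) (H K a t : R) :
  expR (- (a * H * K * t)) *
    ((expR (2 * a * H * t) + 1) `^ K - `|expR (a * t) - 1| `^ (2 * H * K)) =
  (expR (a * H * t) + expR (- (a * H * t))) `^ K
    - `|expR (a * t / 2) - expR (- (a * t / 2))| `^ (2 * H * K).
Proof.
have -> : expR (a * H * t) + expR (- (a * H * t)) =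
    expR (- (a * H * t)) * (expR (2 * a * H * t) + 1).
  by rewrite mulrDr mulr1 -expRD; congr (expR _ + _); ring.
have -> : expR (a * t / 2) - expR (- (a * t / 2)) =
    expR (- (a * t / 2)) * (expR (a * t) - 1).
  by rewrite mulrBr mulr1 -expRD; congr (expR _ - _); field.
rewrite normrM (ger0_norm (expR_ge0 _)) !powRM ?expR_ge0 ?addr_ge0 ?expR_ge0//.
rewrite -!expRM mulrBr.
by congr (expR _ * _ - expR _ * _); field.
Qed.

Theorem theorem2p14 (d : measure_display) (T : measurableType d)
    (R : realType) (P : probability T R) (H K alpha : R)
    (B : {nonneg R} -> {RV P >-> R})
    (H01 : 0 < H < 1) (K01 : 0 < K <= 1) (alpha_gt0 : 0 < alpha)
    (bfbmB : bifractional_brownian_motion H K B) :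
  [/\ forall t : R,
        R_B H K alpha B t =
        ((expR (- (alpha * H * K * t)))%:E *
           'E_P[(B (expR (alpha * t))%:nng \* B 1%:nng)%R])%E,
      forall t : R,
        R_B H K alpha B t =
        (2 `^ (- K) * expR (- (alpha * H * K * t)) *
          ((expR (2 * alpha * H * t) + 1) `^ K
           - `|expR (alpha * t) - 1| `^ (2 * H * K)))%:E,
      R_B H K alpha B 0 = 1%E &
      forall t : R, R_B H K alpha B (- t) = R_B H K alpha B t].
Proof.
have [/andP[H_gt0 _] /andP[K_gt0 _]] := (H01, K01).
have [_ _ covB] := bfbmB.
have R_BE t : R_B H K alpha B t = ((expR (- (alpha * H * K * t)))%:E *
    'E_P[(B (expR (alpha * t))%:nng \* B 1%:nng)%R])%E.
  rewrite -fin_num_expectationZl; last 2 first.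
  - exact: measurable_funM.
  - by rewrite covB.
  congr ('E_P[_])%E; apply/funext => w /=.
  rewrite /lamperti (mulr0 (alpha * H * K)) oppr0 expR0 mul1r mulrA.
  (* The time indices live in [{nonneg R}], so [expR (alpha * 0)] and [1] are identified through
     their values. *)
  by congr (_ * B _ w); apply: val_inj; rewrite /= mulr0 expR0.
have R_B_explicit t : R_B H K alpha B t =
    (2 `^ (- K) * expR (- (alpha * H * K * t)) *
      ((expR (2 * alpha * H * t) + 1) `^ K
       - `|expR (alpha * t) - 1| `^ (2 * H * K)))%:E.
  have expRt : expR (alpha * t) `^ (2 * H) = expR (2 * alpha * H * t).
    by rewrite -expRM; congr expR; ring.
  by rewrite R_BE covB -EFinM /= powR1 expRt mulrCA mulrA.
split=> // [|t].
(* The second term vanishes because [2 * H * K] is nonzero; by convention, 0 to the power 0 is 1. *)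
- rewrite R_B_explicit !mulr0 oppr0 expR0 subrr normr0 powR0; last first.
    by rewrite !mulf_neq0 ?gt_eqF.
  by rewrite subr0 mulr1 powRN mulVf// gt_eqF// powR_gt0.
- rewrite !R_B_explicit -!(mulrA (2 `^ _)).
  rewrite !lamperti_covariance_symmetric.
  (* Negating [t] only swaps the two exponentials in the sum and in the absolute difference. *)
  by rewrite !(mulrN, mulNr) !opprK [X in X `^ K]addrC distrC.
Qed.
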